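(* Let $A\in\mathbb{R}^{d\times d}$ be symmetric and let $b\in\mathbb{R}^d$ be nonzero. Suppose that no unlucky breakdown occurs (as defined in the context). Then in the algorithm ''Conjugate Residual with Pseudo-inverse Solution'' described in the context, applied to $(A,b)$, one has $x^{+}=A^\dagger b$, where $A^\dagger$ is the Moore–Penrose pseudo-inverse of $A$.
   Context: Algorithm (Conjugate Residual with Pseudo-inverse Solution). Input: a symmetric matrix $A$ and a vector $b$. Set $k=1$, $x_0=0$, $r_0=p_0=b$. While $\|Ar_{k-1}\|\neq0$ do: $\alpha_{k-1}=\langle r_{k-1},Ar_{k-1}\rangle/\|Ap_{k-1}\|^2$; $x_k=x_{k-1}+\alpha_{k-1}p_{k-1}$; $r_k=r_{k-1}-\alpha_{k-1}Ap_{k-1}$; $\beta_{k-1}=\langle r_k,Ar_k\rangle/\langle r_{k-1},Ar_{k-1}\rangle$; $p_k=r_k+\beta_{k-1}p_{k-1}$; $k\leftarrow k+1$. After the loop: set $x^\star=x_{k-1}$ (normal solution) and $x^{+}=x_{k-1}-\big(\langle p_{k-1},x_{k-1}\rangle/\|p_{k-1}\|^2\big)p_{k-1}$ (pseudo-inverse solution). Return $x^{+}$. No unlucky breakdown: if $A$ is indefinite, the method does not encounter a zero-curvature direction, i.e. no generated residual $r_{k-1}$ is a nonzero vector outside $\mathrm{Null}(A)$ with $\langle r_{k-1},Ar_{k-1}\rangle=0$. *)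

(* Defs.v *)
From mathcomp Require Import all_boot all_order all_algebra reals.

Set Implicit Arguments.
Unset Strict Implicit.
Unset Printing Implicit Defensive.

Import Order.TTheory GRing.Theory Num.Theory.
Local Open Scope ring_scope.

Section Euclidean.
Variable R : rcfType.

Definition dot n (u v : 'cV[R]_n) : R := \sum_(i < n) u i 0 * v i 0.

(* The norm `|u| that MathComp-Analysis puts on matrices is the max norm. *)
Definition enorm n (u : 'cV[R]_n) : R := Num.sqrt (dot u u).

Definition indefinite n (A : 'M[R]_n) : Prop :=
  (exists u : 'cV[R]_n, 0 < dot u (A *m u)) /\
  (exists v : 'cV[R]_n, dot v (A *m v) < 0).

End Euclidean.

Section MoorePenrose.
Variable R : rcfType.

(* Over the reals, the adjoint in the Penrose equations is the transpose. *)
Definition moore_penrose m n (A : 'M[R]_(m, n)) (X : 'M[R]_(n, m)) : bool :=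
  [&& A *m X *m A == A, X *m A *m X == X,
      (A *m X)^T == A *m X & (X *m A)^T == X *m A].

Lemma gram_unit m n (F : 'M[R]_(m, n)) : row_free F -> F *m F^T \in unitmx.
Proof.
move=> freeF; rewrite -row_free_unit -kermx_eq0; apply/eqP/row_matrixP => i.
rewrite row0; set v := row i _.
have v0 : v *m (F *m F^T) = 0 by rewrite -row_mul mulmx_ker row0.
suff vF0 : v *m F = 0.
  by apply: (row_free_inj freeF); rewrite vF0 mul0mx.
apply/rowP => j; rewrite [RHS]mxE; apply/eqP; rewrite -sqrf_eq0.
have s0 : \sum_k (v *m F) 0 k ^+ 2 = 0.
  transitivity ((v *m (F *m F^T) *m v^T) 0 0); last by rewrite v0 mul0mx mxE.
  have -> : v *m (F *m F^T) *m v^T = (v *m F) *m (v *m F)^T.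
    by rewrite trmx_mul !mulmxA.
  by rewrite [RHS]mxE; apply: eq_bigr => k _; rewrite [_^T _ _]mxE expr2.
by apply/eqP/(psumr_eq0P _ s0) => // k _; apply: sqr_ge0.
Qed.

Lemma moore_penrose_exists m n (A : 'M[R]_(m, n)) :
  exists X : 'M[R]_(n, m), moore_penrose A X.
Proof.
have [r [C [F [AE uF uC]]]] : exists r (C : 'M[R]_(m, r)) (F : 'M[R]_(r, n)),
    [/\ A = C *m F, F *m F^T \in unitmx & C^T *m C \in unitmx].
  exists (\rank A), (col_base A), (row_base A); split.
  - by rewrite mulmx_base.
  - exact/gram_unit/row_base_free.
  - rewrite -{2}[col_base A]trmxK; apply: gram_unit.
    by rewrite /row_free mxrank_tr -/(row_full _) col_base_full.
pose G := invmx (F *m F^T); pose H := invmx (C^T *m C).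
have FG : F *m F^T *m G = 1%:M by apply: mulmxV.
have HC : H *m (C^T *m C) = 1%:M by apply: mulVmx.
have GT : G^T = G by rewrite /G trmx_inv trmx_mul trmxK.
have HT : H^T = H by rewrite /H trmx_inv trmx_mul trmxK.
exists (F^T *m G *m H *m C^T).
have AX : A *m (F^T *m G *m H *m C^T) = C *m H *m C^T.
  rewrite AE; transitivity (C *m (F *m F^T *m G) *m H *m C^T).
    by rewrite !mulmxA.
  by rewrite FG mulmx1.
have XA : F^T *m G *m H *m C^T *m A = F^T *m G *m F.
  rewrite AE; transitivity (F^T *m G *m (H *m (C^T *m C)) *m F).
    by rewrite !mulmxA.
  by rewrite HC mulmx1.
apply/and4P; split; apply/eqP.
- rewrite AX AE; transitivity (C *m (H *m (C^T *m C)) *m F).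
    by rewrite !mulmxA.
  by rewrite HC mulmx1.
- rewrite XA; transitivity (F^T *m G *m (F *m F^T *m G) *m H *m C^T).
    by rewrite !mulmxA.
  by rewrite FG mulmx1.
- by rewrite AX !trmx_mul trmxK HT mulmxA.
- by rewrite XA !trmx_mul trmxK GT mulmxA.
Qed.

Lemma moore_penrose_uniq m n (A : 'M[R]_(m, n)) (X Y : 'M[R]_(n, m)) :
  moore_penrose A X -> moore_penrose A Y -> X = Y.
Proof.
case/and4P=> /eqP x1 /eqP x2 /eqP x3 /eqP x4.
case/and4P=> /eqP y1 /eqP y2 /eqP y3 /eqP y4.
have AXY : A *m X = A *m Y.
  rewrite -[LHS]x3 -{1}y1 -[A *m Y *m A *m X]mulmxA trmx_mul x3 y3.
  by rewrite mulmxA x1.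
have XAY : X *m A = Y *m A.
  rewrite -[LHS]x4 -{1}y1 -[A *m Y *m A]mulmxA mulmxA trmx_mul x4 y4.
  by rewrite -mulmxA [A *m _]mulmxA x1.
by rewrite -x2 -mulmxA AXY mulmxA XAY y2.
Qed.

(* MathComp's pinvmx is a generalized inverse, but not the Moore-Penrose one. *)
Definition mpinv m n (A : 'M[R]_(m, n)) : 'M[R]_(n, m) :=
  xchoose (moore_penrose_exists A).

Lemma mpinvP m n (A : 'M[R]_(m, n)) : moore_penrose A (mpinv A).
Proof. exact: xchooseP. Qed.

End MoorePenrose.

Section ConjugateResidual.
Variables (R : rcfType) (d : nat).

Record cr_state := CRState { cr_x : 'cV[R]_d; cr_r : 'cV[R]_d; cr_p : 'cV[R]_d }.

Variables (A : 'M[R]_d) (b : 'cV[R]_d).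

Definition cr_init : cr_state := CRState 0 b b.

Definition cr_continue (s : cr_state) : bool := enorm (A *m cr_r s) != 0.

Definition cr_step (s : cr_state) : cr_state :=
  let: CRState x r p := s in
  let alpha := dot r (A *m r) / enorm (A *m p) ^+ 2 in
  let x' := x + alpha *: p in
  let r' := r - alpha *: (A *m p) in
  let beta := dot r' (A *m r') / dot r (A *m r) in
  let p' := r' + beta *: p in
  CRState x' r' p'.

(* Iterate number k of the loop body. It is an iterate of the algorithm only
   when cr_generated k holds. *)
Definition cr_iter (k : nat) : cr_state := iter k cr_step cr_init.

Definition cr_generated (k : nat) : Prop :=
  forall j : nat, (j < k)%N -> cr_continue (cr_iter j).

(* If the last direction p is 0, the correction term is 0 and x^+ = x,
   whatever the value of the quotient. *)
Definition cr_output (s : cr_state) : 'cV[R]_d :=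
  cr_x s - (dot (cr_p s) (cr_x s) / enorm (cr_p s) ^+ 2) *: cr_p s.

Definition cr_returns (y : 'cV[R]_d) : Prop :=
  exists k : nat, [/\ cr_generated k, ~~ cr_continue (cr_iter k)
                    & cr_output (cr_iter k) = y].

Lemma cr_returns_uniq (y z : 'cV[R]_d) : cr_returns y -> cr_returns z -> y = z.
Proof.
move=> [k [gk sk <-]] [l [gl sl <-]].
case: (ltngtP k l) => [kl|lk|-> //].
- by rewrite gl in sk.
- by rewrite gk in sl.
Qed.

Definition no_unlucky_breakdown : Prop :=
  indefinite A ->
  forall k : nat, cr_generated k ->
    let r := cr_r (cr_iter k) in
    ~ [/\ r != 0, A *m r != 0 & dot r (A *m r) = 0].

End ConjugateResidual.

(* Main.v *)
Require Import Defs.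
From mathcomp Require Import all_boot all_order all_algebra reals.
From mathcomp Require Import ring lra.

(** The loop terminates because the residuals are conjugate.  As for the
    conjugate gradient method, a simultaneous induction ([cr_conjugacy]) shows
    that each new residual [r_k] is [A]-orthogonal to the earlier residuals and
    directions, and that the vectors [A p_i] are pairwise orthogonal.  The
    induction divides by the curvatures [<r_i, A r_i>], which do not vanish as
    long as the loop runs: a vector with zero curvature outside the null space
    of [A] is a saddle of the quadratic form, so [A] would be indefinite and the
    absence of unlucky breakdown applies ([zero_curvature_indefinite]).  Vectors
    that are pairwise [A]-orthogonal with nonzero curvatures are linearly
    independent, so there are at most [d] of them ([conjugate_family_bound]).

    The output is identified at the first [k] with [A r_k = 0].  Write [X] for
    the pseudo-inverse of [A] and [N = 1 - X A] for the orthogonal projector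
    onto the null space.  Every iterate is a polynomial in [A] applied to [b];
    since [N A = 0], its projection by [N] is a multiple of [N b]
    ([cr_null_component]).  Also [r_k = b - A x_k], so that at the end
    [r_k = N r_k = N b], and hence [x_k = X b + c r_k] for some scalar [c], where
    [X b] lies in the range of [A] and so is orthogonal to [r_k].  Finally the
    last [beta] is [0], so [p_k = r_k], and the correction step of the algorithm
    removes exactly the component [c r_k] ([cr_output_mpinv]). *)

Set Implicit Arguments.
Unset Strict Implicit.
Unset Printing Implicit Defensive.

Import Order.TTheory GRing.Theory Num.Theory.
Local Open Scope ring_scope.

(** * The Euclidean inner product *)

Section DotTheory.
Variables (R : rcfType) (n : nat).
Implicit Types (u v w : 'cV[R]_n) (A : 'M[R]_n) (a : R).

Lemma dotE u v : dot u v = (u^T *m v) 0 0.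
Proof. by rewrite mxE; apply: eq_bigr => i _; rewrite mxE. Qed.

Lemma dotC u v : dot u v = dot v u.
Proof. by apply: eq_bigr => i _; rewrite mulrC. Qed.

Lemma dotDl u v w : dot (u + v) w = dot u w + dot v w.
Proof. by rewrite !dotE linearD mulmxDl mxE. Qed.

Lemma dotZl a u v : dot (a *: u) v = a * dot u v.
Proof. by rewrite !dotE linearZ /= -scalemxAl mxE. Qed.

Lemma dotBl u v w : dot (u - v) w = dot u w - dot v w.
Proof. by rewrite dotDl -scaleN1r dotZl mulN1r. Qed.

Lemma dotDr u v w : dot w (u + v) = dot w u + dot w v.
Proof. by rewrite ![dot w _]dotC dotDl. Qed.

Lemma dotZr a u v : dot v (a *: u) = a * dot v u.
Proof. by rewrite ![dot v _]dotC dotZl. Qed.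

Lemma dotBr u v w : dot w (u - v) = dot w u - dot w v.
Proof. by rewrite ![dot w _]dotC dotBl. Qed.

Lemma dot0l v : dot 0 v = 0.
Proof. by rewrite -(scale0r 0) dotZl mul0r. Qed.

Lemma dot_ge0 u : 0 <= dot u u.
Proof. by apply: sumr_ge0 => i _; rewrite -expr2 sqr_ge0. Qed.

Lemma dot_eq0 u : (dot u u == 0) = (u == 0).
Proof.
apply/eqP/eqP => [uu0 | ->]; last exact: dot0l.
apply/colP => i; rewrite mxE; apply/eqP; rewrite -sqrf_eq0 expr2.
by apply/eqP/(psumr_eq0P _ uu0) => // j _; rewrite -expr2 sqr_ge0.
Qed.

Lemma enorm_sqr u : enorm u ^+ 2 = dot u u.
Proof. exact/sqr_sqrtr/dot_ge0. Qed.

Lemma enorm_eq0 u : (enorm u == 0) = (u == 0).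
Proof. by rewrite -sqrf_eq0 enorm_sqr dot_eq0. Qed.

Lemma dot_mulmx A u v : dot u (A *m v) = dot (A^T *m u) v.
Proof. by rewrite !dotE trmx_mul trmxK mulmxA. Qed.

Lemma dot_sym A : A^T = A -> forall u v, dot (A *m u) v = dot u (A *m v).
Proof. by move=> symA u v; rewrite dot_mulmx symA. Qed.

(** A point of zero curvature that is not in the null space is a saddle: along
    the line [u + t A u] the form equals [t (2 |A u|^2 + t c)], which changes
    sign at [t = 0]. *)
Lemma zero_curvature_indefinite A u :
  A^T = A -> A *m u != 0 -> dot u (A *m u) = 0 -> indefinite A.
Proof.
move=> symA Au0 uAu0; set w := A *m u.
set a := dot w w; set c := dot w (A *m w).
have a_gt0 : 0 < a by rewrite lt0r dot_eq0 Au0 dot_ge0.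
have lineE t : dot (u + t *: w) (A *m (u + t *: w)) = t * (2 * a + t * c).
  rewrite mulmxDr -scalemxAr !dotDl !dotDr !dotZl !dotZr uAu0.
  by rewrite -(dot_sym symA u w) -/w -/a -/c; ring.
(* With this t, the term t * c cannot outweigh 2 * a. *)
pose t := a / (1 + `|c|).
have c1_gt0 : 0 < 1 + `|c| by rewrite ltr_wpDr.
have t_gt0 : 0 < t by rewrite divr_gt0.
have tc_le : `|t * c| <= a.
  rewrite normrM gtr0_norm // mulrAC ler_pdivrMr // ler_wpM2l ?ltW //.
  by rewrite ltrDr.
have /andP[lo hi] : - a <= t * c <= a by rewrite -ler_norml.
split.
- by exists (u + t *: w); rewrite lineE pmulr_rgt0 //; lra.
- exists (u + (- t) *: w); rewrite lineE mulNr oppr_lt0 pmulr_rgt0 //; lra.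
Qed.

(** The matrix [M] with rows [f i] has [M A M^T] diagonal and invertible, so its
    rank is [m]. *)
Lemma conjugate_family_bound m A (f : 'I_m -> 'cV[R]_n) :
  (forall i, dot (f i) (A *m f i) != 0) ->
  (forall i j, i != j -> dot (f i) (A *m f j) = 0) -> (m <= n)%N.
Proof.
move=> diag0 offdiag.
pose M := \matrix_(i < m, j < n) f i j 0.
pose D := \row_(i < m) dot (f i) (A *m f i).
have MAME : M *m A *m M^T = diag_mx D.
  apply/matrixP => i j; rewrite -mulmxA !mxE.
  transitivity (dot (f i) (A *m f j)).
    apply: eq_bigr => k _; rewrite !mxE; congr (_ * _).
    by apply: eq_bigr => l _; rewrite !mxE.
  by have [-> | /offdiag ->] := eqVneq i j; rewrite ?mulr1n ?mulr0n.
have /mxrank_unit rkD : diag_mx D \in unitmx.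
  rewrite unitmxE det_diag unitfE; apply/prodf_neq0 => i _.
  by rewrite mxE.
rewrite -rkD -MAME -mulmxA.
exact: leq_trans (mxrankM_maxl _ _) (rank_leq_col _).
Qed.

End DotTheory.

(** * Conjugacy and termination *)

Section ConjugateResidualTheory.
Variables (R : rcfType) (d : nat) (A : 'M[R]_d) (b : 'cV[R]_d).
Hypothesis symA : A^T = A.

Local Notation x k := (cr_x (cr_iter A b k)).
Local Notation r k := (cr_r (cr_iter A b k)).
Local Notation p k := (cr_p (cr_iter A b k)).
Local Notation curv k := (dot (r k) (A *m r k)).
Local Notation alpha k := (curv k / enorm (A *m p k) ^+ 2).
Local Notation beta k := (curv k.+1 / curv k).

Lemma cr_xS k : x k.+1 = x k + alpha k *: p k.
Proof. by rewrite /cr_iter iterS; case: (iter k _ _). Qed.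

Lemma cr_rS k : r k.+1 = r k - alpha k *: (A *m p k).
Proof. by rewrite /cr_iter iterS; case: (iter k _ _). Qed.

Lemma cr_pS k : p k.+1 = r k.+1 + beta k *: p k.
Proof. by rewrite /cr_iter iterS; case: (iter k _ _). Qed.

Lemma cr_continueE k : cr_continue A (cr_iter A b k) = (A *m r k != 0).
Proof. by rewrite /cr_continue enorm_eq0. Qed.

Lemma cr_generatedW k j : (j <= k)%N -> cr_generated A b k -> cr_generated A b j.
Proof. by move=> jk gk i ij; apply/gk/(leq_trans ij). Qed.

Lemma curvature_neq0 k :
  no_unlucky_breakdown A b -> cr_generated A b k.+1 -> curv k != 0.
Proof.
move=> nobreak gk; apply/eqP => curv0.
have Ar0 : A *m r k != 0 by rewrite -cr_continueE gk.
have indefA := zero_curvature_indefinite symA Ar0 curv0.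
apply: (nobreak indefA k (cr_generatedW (leqnSn k) gk)); split=> //.
by apply: contraNneq Ar0 => ->; rewrite mulmx0.
Qed.

(** In the inductive step, the first conjunct for [i < k] is immediate, and for
    [i = k] it is what [alpha] is chosen for.  The second follows from the first
    because [r_i] is a combination of [p_i] and [p_(i-1)].  The third for [i < k]
    follows from the second because [A p_i] is a multiple of [r_i - r_(i+1)], and
    for [i = k] it is what [beta] is chosen for.  The fourth makes the
    denominators of the [alpha]s nonzero: [r_i] is orthogonal to [A p_(i-1)], so
    [<r_i, A p_i>] is the curvature of [r_i]. *)
Lemma cr_conjugacy k :
  (forall i, (i < k)%N -> curv i != 0) -> forall i, (i < k)%N ->
  [/\ dot (r k) (A *m p i) = 0, dot (r k) (A *m r i) = 0,
      dot (A *m p k) (A *m p i) = 0 & A *m p i != 0].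
Proof.
elim: k => // k IH curv0.
have {}IH i : (i < k)%N -> [/\ dot (r k) (A *m p i) = 0,
    dot (r k) (A *m r i) = 0, dot (A *m p k) (A *m p i) = 0 & A *m p i != 0].
  by apply: IH => j jk; apply/curv0/ltnW.
have rpE : dot (r k) (A *m p k) = curv k.
  case: k IH {curv0} => // k IH.
  have [rp0 _ _ _] := IH k (ltnSn k).
  by rewrite cr_pS mulmxDr -scalemxAr dotDr dotZr rp0 mulr0 addr0.
have Apk0 : A *m p k != 0.
  apply: contraNneq (curv0 k (ltnSn k)) => Ap0.
  by rewrite -rpE Ap0 dotC dot0l.
have rp i : (i < k.+1)%N -> dot (r k.+1) (A *m p i) = 0.
  rewrite ltnS leq_eqVlt => /predU1P[-> | ik]; rewrite cr_rS dotBl dotZl.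
    by rewrite rpE enorm_sqr divfK ?dot_eq0 ?subrr.
  by have [-> _ -> _] := IH i ik; rewrite mulr0 subrr.
have rr i : (i < k.+1)%N -> dot (r k.+1) (A *m r i) = 0.
  case: i => [|i] ik; first exact: (rp 0%N).
  have -> : r i.+1 = p i.+1 - beta i *: p i by rewrite cr_pS addrK.
  rewrite mulmxBr -scalemxAr dotBr dotZr rp // rp ?(ltnW ik) //.
  by rewrite mulr0 subrr.
move=> i ik.
have Api0 : A *m p i != 0.
  by move: ik; rewrite ltnS leq_eqVlt => /predU1P[-> | /IH[]].
split; [exact: rp | exact: rr | | exact: Api0].
(* A *m p i is a multiple of r i - r i.+1 only after division by alpha i, whose
   denominator must also be nonzero because inversion sends 0 to 0. *)
have alpha0 : alpha i != 0.
  by rewrite mulf_neq0 ?curv0 // invr_neq0 // enorm_sqr dot_eq0.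
apply: (mulfI alpha0); rewrite mulr0 cr_pS mulmxDr -scalemxAr dotDl dotZl.
rewrite mulrDr -[alpha i * dot (A *m r k.+1) _]dotZr.
have -> : alpha i *: (A *m p i) = r i - r i.+1 by rewrite cr_rS subKr.
rewrite (dot_sym symA (r k.+1)) mulmxBr dotBr (rr i) // sub0r.
move: ik; rewrite ltnS leq_eqVlt => /predU1P[-> | ik].
  by rewrite enorm_sqr; field; rewrite dot_eq0 Apk0 curv0.
have [_ _ -> _] := IH i ik.
by rewrite (rr i.+1) // !mulr0 oppr0 addr0.
Qed.

(** If the loop ran [d + 1] times, [r_0], ..., [r_d] would be too many conjugate
    vectors for dimension [d]. *)
Lemma cr_terminates :
  no_unlucky_breakdown A b ->
  exists2 k, cr_generated A b k & ~~ cr_continue A (cr_iter A b k).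
Proof.
move=> nobreak.
have ex_stop : exists k, ~~ cr_continue A (cr_iter A b k).
  have [/existsP[k stop] | ] :=
      boolP [exists k : 'I_d.+1, ~~ cr_continue A (cr_iter A b k)].
    by exists k.
  rewrite negb_exists => /forallP run.
  have gen : cr_generated A b d.+1.
    by move=> k kd; have := run (Ordinal kd); rewrite negbK.
  have curv0 k : (k < d.+1)%N -> curv k != 0.
    by move=> kd; apply: curvature_neq0 => //; apply: cr_generatedW gen.
  have conj (i j : nat) : (j < i < d.+1)%N -> dot (r i) (A *m r j) = 0.
    case/andP=> ji id; have [//|_ -> _ _ //] := @cr_conjugacy i _ j ji.
    by move=> l li; apply/curv0/(ltn_trans li).
  suff : (d.+1 <= d)%N by rewrite ltnn.
  apply: (@conjugate_family_bound _ _ _ A (fun i : 'I_d.+1 => r i)) => [i | i j].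
    by apply: curv0.
  rewrite -val_eqE /= neq_ltn => /orP[ij | ji].
    by rewrite -dot_sym // dotC conj // ij ltn_ord.
  by rewrite conj // ji ltn_ord.
have [m stop_m min_m] := ex_minnP ex_stop.
exists m => // j jm; apply: contraTT jm => stop_j.
by rewrite -leqNgt min_m.
Qed.

(** * Identification of the output *)

Lemma cr_residualE k : r k = b - A *m x k.
Proof.
elim: k => [|k IH]; first by rewrite mulmx0 subr0.
by rewrite cr_rS cr_xS [A *m (x k + _)]mulmxDr -scalemxAr opprD addrA -IH.
Qed.

(** The recurrences only combine earlier vectors and their images under [A], and
    [N] annihilates the latter. *)
Lemma cr_null_component (N : 'M[R]_d) k : N *m A = 0 ->
  exists c, N *m x k = c *: (N *m b).
Proof.
move=> NA0.
have Nr j : N *m r j = N *m b.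
  by rewrite cr_residualE mulmxBr mulmxA NA0 mul0mx subr0.
suff [] : (exists c, N *m x k = c *: (N *m b)) /\
    (exists e, N *m p k = e *: (N *m b)) by [].
elim: k => [|k [[c xE] [e pE]]].
  by split; [exists 0; rewrite mulmx0 scale0r | exists 1; rewrite scale1r].
split.
  exists (c + alpha k * e).
  by rewrite cr_xS mulmxDr -scalemxAr xE pE scalerDl scalerA.
exists (1 + beta k * e).
by rewrite cr_pS mulmxDr -scalemxAr Nr pE scalerDl scale1r scalerA.
Qed.

Lemma cr_last_direction k : A *m r k = 0 -> p k = r k.
Proof.
case: k => // k Ar0.
by rewrite cr_pS Ar0 [dot _ 0]dotC dot0l mul0r scale0r addr0.
Qed.

(** Once the residual lies in the null space, it is the null-space component of
    [b] and coincides with the direction [p_k], so that [x_k] differs from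
    [mpinv A *m b] by a multiple of [p_k] only.  The pseudo-inverse solution is
    orthogonal to [p_k], hence subtracting the projection on [p_k] recovers it.
    If [r_k = 0], then already [x_k = mpinv A *m b]. *)
Lemma cr_output_mpinv k : A *m r k = 0 -> cr_output (cr_iter A b k) = mpinv A *m b.
Proof.
move=> Ar0; rewrite /cr_output cr_last_direction // enorm_sqr.
set X := mpinv A.
have := mpinvP A; rewrite -/X.
case/and4P=> /eqP AXA /eqP XAX /eqP symAX /eqP symXA.
have XAE : X *m A = A *m X^T by rewrite -symXA trmx_mul symA.
have AXE : A *m X = X^T *m A by rewrite -symAX trmx_mul symA.
pose N := 1%:M - X *m A.
have NA0 : N *m A = 0.
  have := congr1 trmx AXA; rewrite !trmx_mul symA mulmxA => AXTA.
  by rewrite /N mulmxBl mul1mx XAE AXTA subrr.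
have Nr : N *m r k = r k by rewrite /N mulmxBl mul1mx -mulmxA Ar0 mulmx0 subr0.
have Nb : N *m b = r k.
  by rewrite -Nr cr_residualE mulmxBr mulmxA NA0 mul0mx subr0.
have Xr : X *m r k = 0.
  by rewrite -XAX -(mulmxA X) AXE -!mulmxA Ar0 !mulmx0.
have [c xE] := cr_null_component k NA0.
have {}xE : x k = X *m b + c *: r k.
  have Ax : A *m x k = b - r k by rewrite cr_residualE subKr.
  rewrite -Nb -xE /N mulmxBl mul1mx -mulmxA Ax mulmxBr Xr subr0.
  by rewrite addrC subrK.
have rXb : dot (r k) (X *m b) = 0.
  by rewrite -XAX XAE -!mulmxA -dot_sym // Ar0 dot0l.
rewrite xE dotDr dotZr rXb add0r.
have [-> | r0] := eqVneq (r k) 0; first by rewrite !scaler0 addr0 subr0.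
by rewrite mulfK ?dot_eq0 // addrK.
Qed.

End ConjugateResidualTheory.

Theorem theorem4 (R : realType) (d : nat) (A : 'M[R]_d) (b : 'cV[R]_d)
    (hA : A^T = A) (hb : b != 0) (hnb : no_unlucky_breakdown A b) :
  cr_returns A b (mpinv A *m b).
Proof.
have [k gen stop] := cr_terminates hA hnb.
exists k; split=> //; apply: cr_output_mpinv => //.
by apply/eqP; rewrite -[_ == _]negbK -cr_continueE.
Qed.
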